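(* Let $G$ be a group acting on a set $S$ and let $R \subset S$ be a subset. Assume that: (i) $G$ acts transitively on $S$; (ii) $R$ is commensurated by $G$, and $R$ and $S \setminus R$ are both infinite. Then $G$ acts on an infinite cube $X$ without bounded orbit, and every subgroup $H < G$ with bounded orbits in $X$ fixes a vertex of $X$. Moreover, if (iii) $\mathrm{Stab}(T) = \{g \in G : gT = T\}$ is finite for every $T \subset S$ such that $T \triangle R$ is finite, then $G$ acts properly on $X$.
   Context: A subset $Y$ of a $G$-set $S$ is commensurated by $G$ if $|gY \triangle Y| < \infty$ for all $g \in G$, where $\triangle$ denotes symmetric difference. For an infinite set $I$, the set $\mathcal{P}(I)$ of all subsets of $I$ carries a cube complex structure: the vertices are the subsets of $I$, two vertices are joined by an edge if and only if their symmetric difference has exactly one element, and the $n$-cubes correspond to pairs $(A,F)$ with $F \subset I$ of cardinality $n$ and $A \subset I \setminus F$, the vertices of the cube being the sets $A \cup B$, $B \subset F$. The connected component of a vertex $A$ consists of the subsets with finite symmetric difference with $A$ (and the cubes they span). An infinite cube is a cube complex isomorphic to such a connected component; it is an infinite-dimensional CAT(0) cube complex. Cube complexes carry the metric induced by giving each cube the metric of a Euclidean unit cube; actions on cube complexes are by cubical automorphisms. Boundedness of orbits is with respect to this metric. An action on a cube complex is proper if the stabilizers of all cubes are finite. *)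

(* Defs.v *)
From mathcomp Require Import all_boot all_order all_algebra.
From mathcomp Require Import all_classical all_reals ereal.

Set Implicit Arguments.
Unset Strict Implicit.
Unset Printing Implicit Defensive.

Import Order.TTheory GRing.Theory Num.Theory.

Local Open Scope classical_set_scope.
Local Open Scope ring_scope.

Record gaction (G : groupType) (S : Type) := GAction {
  gaction_fun :> G -> S -> S;
  gaction1 : forall s, gaction_fun 1%g s = s;
  gactionM : forall g h s, gaction_fun (g * h)%g s = gaction_fun g (gaction_fun h s)
}.

Definition transitive_action (G : groupType) (S : Type) (a : gaction G S) :=
  forall s t, exists g, a g s = t.

Definition stabilizer (G : groupType) (S : Type) (a : gaction G S)
  (T : set S) : set G := [set g | a g @` T = T].

Definition commensurated (G : groupType) (S : Type) (a : gaction G S)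
  (Y : set S) := forall g, finite_set ((a g @` Y) `+` Y).

Definition power_cube (I : Type) (A F : set I) : set (set I) :=
  [set A `|` B | B in [set B | B `<=` F]].

(* The vertex sets of the cubes of P(I). With I = 'I_n these are the vertex
   sets of the faces of the standard cube [0,1]^n, a subset B of 'I_n being
   the vertex whose coordinates equal to 1 are those indexed by B. *)
Definition is_power_cube (I : Type) (D : set (set I)) :=
  exists A F : set I, [/\ finite_set F, A `&` F = set0 & D = power_cube A F].

(* f identifies the vertices of the standard n-cube with those of a cube, in
   such a way that faces correspond to faces. As setT is a power cube, the
   range of a chart is itself a cube. *)
Definition is_chart (V : Type) (cube : set (set V)) (n : nat)
    (f : set 'I_n -> V) :=
  injective f /\ forall D, cube (f @` D) <-> is_power_cube D.

(* Cube complexes in the sense of Bridson and Haefliger: cubes are embedded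
   and two cubes meet in a common face or not at all. A cube is then
   determined by its vertices, and is represented by its vertex set. *)
Record cubeComplex := CubeComplex {
  vertex : Type;
  cube : set (set vertex);
  cube1 : forall v, cube [set v];
  cubeI : forall c c', cube c -> cube c' -> c `&` c' !=set0 ->
    cube (c `&` c');
  cube_chart : forall c, cube c -> exists n (f : set 'I_n -> vertex),
    is_chart cube f /\ range f = c
}.

Definition cubical_iso (X Y : cubeComplex) (f : vertex X -> vertex Y) :=
  bijective f /\ forall c, cube c <-> cube (f @` c).

Section Component.
Variables (I : Type) (A0 : set I).

Definition comp_vertex := {B : set I | finite_set (B `+` A0)}.

Definition comp_cube : set (set comp_vertex) :=
  [set D | is_power_cube (@sval _ _ @` D)].

Lemma power_cubeE (J : Type) (A F X : set J) :
  power_cube A F X <-> A `<=` X /\ X `<=` A `|` F.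
Proof.
split=> [[B BF <-]|[AX XAF]].
  by split; [exact: subsetUl|exact: setUS].
exists (X `\` A) => [x [/XAF []//]|]; exact: setDUK.
Qed.

Lemma is_power_cubeP (J : Type) (D : set (set J)) :
  is_power_cube D <-> exists A B : set J,
    [/\ A `<=` B, finite_set (B `\` A) & D = [set X | A `<=` X /\ X `<=` B]].
Proof.
split=> [[A [F [finF AF0 ->]]]|[A [B [AB finBA ->]]]].
  exists A, (A `|` F); split; first exact: subsetUl.
    by apply: sub_finite_set finF => x [[]].
  by apply/seteqP; split=> X /power_cubeE.
exists A, (B `\` A); split=> //; first by rewrite setDIK.
by apply/seteqP; split=> X; rewrite power_cubeE setDUK.
Qed.

Lemma sval_comp_inj : injective (@sval _ _ : comp_vertex -> set I).
Proof. by move=> [x xP] [y yP] /= xy; apply: eq_exist. Qed.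

Lemma comp_cube1 v : comp_cube [set v].
Proof.
apply/is_power_cubeP; exists (sval v), (sval v).
rewrite setDv image_set1; split=> //.
by apply/seteqP; split=> X /= => [->//|[? ?]]; apply/seteqP.
Qed.

Lemma comp_cubeI c c' : comp_cube c -> comp_cube c' -> c `&` c' !=set0 ->
  comp_cube (c `&` c').
Proof.
move=> /is_power_cubeP[A [B [AB fin e]]] /is_power_cubeP[A' [B' [_ _ e']]].
have sub w : c w -> A `<=` sval w /\ sval w `<=` B.
  move=> cw; suff : [set X | A `<=` X /\ X `<=` B] (sval w) by [].
  by rewrite -e; exists w.
have sub' w : c' w -> A' `<=` sval w /\ sval w `<=` B'.
  move=> cw; suff : [set X | A' `<=` X /\ X `<=` B'] (sval w) by [].
  by rewrite -e'; exists w.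
move=> [v [/sub[Av vB] /sub'[A'v vB']]]; apply/is_power_cubeP.
exists (A `|` A'), (B `&` B'); split.
- by move=> x [/Av|/A'v] xv; split; [exact: vB|exact: vB'|exact: vB|exact: vB'].
- by apply: sub_finite_set fin => x [[Bx _] nA]; split=> // Ax; apply: nA; left.
apply/seteqP; split=> X.
  move=> [w [/sub[? ?] /sub'[? ?]] <-] /=.
  by rewrite subUset subsetI.
rewrite /= subUset subsetI => -[[AX A'X] [XB XB']].
have : [set X | A `<=` X /\ X `<=` B] X by [].
rewrite -e => -[w cw wX].
have : [set X | A' `<=` X /\ X `<=` B'] X by [].
rewrite -e' => -[w' c'w' w'X].
have ww' : w = w' by apply: sval_comp_inj; rewrite wX w'X.
by exists w => //; split=> //; rewrite ww'.
Qed.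

Lemma comp_cube_chart c : comp_cube c ->
  exists n (f : set 'I_n -> comp_vertex), is_chart comp_cube f /\ range f = c.
Proof.
move=> [A [F [finF AF0 e]]].
have [n /card_bijP[phi [psi phiK psiK]]] := finF.
pose u (i : 'I_n) : I := val (psi (SigSub (mem_set (ltn_ord i : `I_n i)))).
have uF i : F (u i) by exact/set_mem/valP.
have uinj : injective u.
  by move=> i j /val_inj/(can_inj psiK)[/val_inj].
have usurj x : F x -> exists i, u i = x.
  move=> Fx; pose y := phi (SigSub (mem_set Fx)).
  exists (Ordinal (set_mem (valP y) : (val y < n)%N)); rewrite /u.
  set z := SigSub _; have -> : z = y by exact: val_inj.
  by rewrite phiK.
pose h (B : set 'I_n) := A `|` u @` B.
have hle B B' : h B `<=` h B' <-> B `<=` B'.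
  split=> [hBB' i Bi|BB']; last by apply: setUS; exact: image_subset.
  have [Au|[j B'j /uinj <-]//] : h B' (u i) by apply: hBB'; right; exists i.
  by have : (A `&` F) (u i) by []; rewrite AF0.
have hsurj X : A `<=` X -> X `<=` A `|` F -> exists B, h B = X.
  move=> AX XAF; exists (u @^-1` X); apply/seteqP; split=> x.
    by case=> [/AX//|[i ? <-]].
  move=> Xx; have [Ax|Fx] := XAF _ Xx; first by left.
  by have [i ui] := usurj _ Fx; right; exists i => //=; rewrite /preimage /= ui.
have hc B : exists v, c v /\ sval v = h B.
  have : power_cube A F (h B).
    by exists (u @` B) => // _ [i _ <-]; exact: uF.
  by rewrite -e => -[v cv vB]; exists v.
have [f fP] := choice hc.
have hinj : injective h.
  by move=> B B' E; apply/seteqP; split; apply/hle; rewrite E.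
exists n, f; split; last first.
  apply/seteqP; split=> [_ [B _ <-]|v cv]; first by have [] := fP B.
  have : power_cube A F (sval v) by rewrite -e; exists v.
  move=> /power_cubeE[Av vAF]; have [B hB] := hsurj _ Av vAF.
  by exists B => //; apply: sval_comp_inj; have [_ ->] := fP B.
split=> [B B' E|D].
  by apply: hinj; have [_ <-] := fP B; have [_ <-] := fP B'; rewrite E.
have -> : comp_cube (f @` D) = is_power_cube (h @` D).
  rewrite /comp_cube /= image_comp; congr is_power_cube.
  by apply: eq_imagel => B _ /=; have [_ ->] := fP B.
split=> /is_power_cubeP[P [Q [PQ finPQ E]]]; apply/is_power_cubeP.
  have [P' DP' hP'] : (h @` D) P by rewrite E; split.
  have [Q' DQ' hQ'] : (h @` D) Q by rewrite E; split.
  exists P', Q'; split; first by apply/hle; rewrite hP' hQ'.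
    exact: finite_finset.
  apply/seteqP; split=> X /=.
    move=> DX; have : (h @` D) (h X) by exists X.
    by rewrite E /= -hP' -hQ' => -[/hle ? /hle ?].
  move=> [/hle PX /hle XQ]; have : (h @` D) (h X).
    by rewrite E /= -hP' -hQ'.
  by move=> [Y DY /hinj <-].
exists (h P), (h Q); split; first exact/hle.
  apply: sub_finite_set finF => x [[Ax nh|[i Qi <-] _]]; last exact: uF.
  by exfalso; apply: nh; left.
apply/seteqP; split=> X /=.
  by move=> [B + <-]; rewrite E => -[PB BQ]; split; apply/hle.
move=> [PX XQ]; have [B hB] : exists B, h B = X.
  apply: hsurj; first by apply: subset_trans PX; exact: subsetUl.
  by apply: subset_trans XQ _; apply: setUS => _ [i _ <-]; exact: uF.
by exists B => //; rewrite E; split; apply/hle; rewrite hB.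
Qed.

Definition power_component : cubeComplex :=
  CubeComplex comp_cube1 comp_cubeI comp_cube_chart.

End Component.

Definition infinite_cube (X : cubeComplex) :=
  exists (I : Type) (A : set I), infinite_set [set: I] /\
    exists f : vertex X -> vertex (power_component A), cubical_iso f.

Record cubicalAction (G : groupType) (X : cubeComplex) := CubicalAction {
  cact :> gaction G (vertex X);
  cact_iso : forall g, cubical_iso (cact g)
}.

Definition proper_action (G : groupType) (X : cubeComplex)
  (a : cubicalAction G X) :=
  forall c, cube c -> finite_set (stabilizer a c).

(* A point of the geometric realization, given by its coordinates in a chart.
   Different values may represent the same point, see glued below. *)
Record rpoint (K : realType) (X : cubeComplex) := RPoint {
  pdim : nat;
  pchart : set 'I_pdim -> vertex X;
  pchartP : is_chart (@cube X) pchart;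
  pcoord : 'rV[K]_pdim;
  pcoordP : forall i, 0 <= pcoord 0 i <= 1
}.

Arguments pchart {K X} r _.
Arguments pcoordP {K X} r _.

(* The vertex of [0,1]^n indexed by B. *)
Definition corner (K : realType) (n : nat) (B : set 'I_n) : 'rV[K]_n :=
  \row_i (i \in B)%:R.

(* The cube of p is a face of the cube of q, and the affine inclusion
   [0,1]^(pdim p) -> [0,1]^(pdim q) of this face maps p to q. *)
Definition glued (K : realType) (X : cubeComplex) (p q : rpoint K X) :=
  exists (M : 'M[K]_(pdim p, pdim q)) (b : 'rV[K]_(pdim q)),
    (forall B, exists2 B', pchart q B' = pchart p B &
       corner K B' = corner K B *m M + b) /\
    pcoord q = pcoord p *m M + b.

Definition euclid (K : realType) (n : nat) (x y : 'rV[K]_n) : K :=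
  Num.sqrt (\sum_i (x 0 i - y 0 i) ^+ 2).

(* cube_path p q l: there is a finite sequence of points from p to q,
   consecutive ones lying in a common cube, of total length l. *)
Inductive cube_path (K : realType) (X : cubeComplex) :
    rpoint K X -> rpoint K X -> K -> Prop :=
| cube_path_nil p : cube_path p p 0
| cube_path_glue p q r l :
    glued p q \/ glued q p -> cube_path q r l -> cube_path p r l
| cube_path_move n (f : set 'I_n -> vertex X) (fP : is_chart (@cube X) f)
    (x y : 'rV[K]_n) (xP : forall i, 0 <= x 0 i <= 1)
    (yP : forall i, 0 <= y 0 i <= 1) r l :
    cube_path (RPoint fP yP) r l -> cube_path (RPoint fP xP) r (euclid x y + l).

(* The length pseudometric on the glued cubes; +oo between distinct connected components *)
Definition dist (K : realType) (X : cubeComplex) (p q : rpoint K X) : \bar K :=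
  ereal_inf [set l%:E | l in cube_path p q].

Definition dist_bounded (K : realType) (X : cubeComplex)
    (A : set (rpoint K X)) :=
  exists M : K, forall p q, A p -> A q -> (dist p q <= M%:E)%E.

Lemma chart_iso (X Y : cubeComplex) (a : vertex X -> vertex Y) (n : nat)
    (f : set 'I_n -> vertex X) :
  cubical_iso a -> is_chart (@cube X) f -> is_chart (@cube Y) (a \o f).
Proof.
move=> [abij acube] [finj fcube]; split; first exact: inj_comp (bij_inj abij) _.
by move=> D; rewrite -image_comp -acube.
Qed.

Definition pact (K : realType) (G : groupType) (X : cubeComplex)
    (a : cubicalAction G X) (g : G) (p : rpoint K X) : rpoint K X :=
  RPoint (chart_iso (cact_iso a g) (pchartP p)) (pcoordP p).

Definition point_orbit (K : realType) (G : groupType) (X : cubeComplex)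
    (a : cubicalAction G X) (H : {pred G}) (p : rpoint K X) : set (rpoint K X) :=
  [set pact a h p | h in [set` H]].

(* Main.v *)
Require Import Defs.
From mathcomp Require Import all_boot all_order all_algebra.
From mathcomp Require Import all_classical all_reals ereal.
From mathcomp Require Import ring lra.

(** The cube is the component of [R] in the power set of [S], on which [G] acts
    because [R] is commensurated. Four facts make everything work.

    - Distances dominate the l^2 distance of indicator functions. The indicator
      of a vertex extends affinely over cubes to a map from the complex to the
      functions on [S], and this map is isometric on each cube: a chart flips
      membership of a distinct element of [S] along each of its directions
      ([chart_flips]). Testing this map against a weight that takes the values
      1 and -1 on a finite set [E] gives a Lipschitz function
      ([cube_path_lower_bound]), hence a bounded orbit forces the symmetric
      differences of [h v] and [v] to have bounded cardinality
      ([bounded_orbit_bounded_discrepancy]).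

    - A subgroup [H] that moves a commensurated set by a bounded amount fixes a
      set at finite distance from it ([bounded_commensurated_fixed]). In the
      affine space of functions that agree with the indicator of [R] off a
      finite set, an almost minimizer of the radius of the orbit of [R] is
      almost invariant, by the parallelogram law. An exact circumcenter, and
      with it the completeness of l^2, can be avoided: if [f] varies by at
      most 1/4 on each [H]-orbit, then the union [T] of the orbits on which [f]
      exceeds 1/2 somewhere is invariant on the nose, [f] is at least 1/4 on
      [T] and at most 1/2 off [T], so that [T] and [R] differ only where [f]
      differs from the indicator of [R].

    - A set fixed by a transitive action is empty or full, and neither is at
      finite distance from [R]. So the orbits of the whole group are unbounded.

    - A cube is an interval for inclusion, which the action preserves, so that
      stabilizing a cube means fixing its least vertex. *)

Set Implicit Arguments.
Unset Strict Implicit.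
Unset Printing Implicit Defensive.

Import Order.TTheory GRing.Theory Num.Theory.

Local Open Scope classical_set_scope.
Local Open Scope ring_scope.

(** * Commensurated sets *)

Lemma gactionK (G : groupType) (S : Type) (a : gaction G S) g :
  cancel (a g) (a g^-1%g).
Proof. by move=> s; rewrite -gactionM mulVg gaction1. Qed.

Lemma gactionKV (G : groupType) (S : Type) (a : gaction G S) g :
  cancel (a g^-1%g) (a g).
Proof. by move=> s; rewrite -gactionM mulgV gaction1. Qed.

Lemma gaction_inj (G : groupType) (S : Type) (a : gaction G S) g :
  injective (a g).
Proof. exact: can_inj (gactionK a g). Qed.

Lemma gaction_imageE (G : groupType) (S : Type) (a : gaction G S) g
  (Y : set S) s : (a g @` Y) s <-> Y (a g^-1%g s).
Proof.
split=> [[t Yt <-]|Ys]; first by rewrite gactionK.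
by exists (a g^-1%g s) => //; rewrite gactionKV.
Qed.

Lemma gaction_image1 (G : groupType) (S : Type) (a : gaction G S)
  (Y : set S) : a 1%g @` Y = Y.
Proof.
by apply/seteqP; split=> s; rewrite gaction_imageE invg1 gaction1.
Qed.

Lemma gaction_imageM (G : groupType) (S : Type) (a : gaction G S) g h
  (Y : set S) : a (g * h)%g @` Y = a g @` (a h @` Y).
Proof.
by apply/seteqP; split=> s; rewrite !gaction_imageE invgM gactionM.
Qed.

Lemma in_setY (I : Type) (A B : set I) i :
  (i \in A `+` B) = (i \in A) (+) (i \in B).
Proof.
by rewrite /setY in_setU !in_setD; case: (i \in A); case: (i \in B).
Qed.

Lemma in_gaction_image (G : groupType) (S : Type) (a : gaction G S) g
  (Y : set S) s : (s \in a g @` Y) = (a g^-1%g s \in Y).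
Proof. by apply/idP/idP => /set_mem/gaction_imageE/mem_set. Qed.

Lemma gaction_imageY (G : groupType) (S : Type) (a : gaction G S) g
  (Y Z : set S) : a g @` (Y `+` Z) = (a g @` Y) `+` (a g @` Z).
Proof.
by apply/seteqP; split=> s /mem_set sP; apply/set_mem; move: sP;
  rewrite in_setY !in_gaction_image in_setY.
Qed.

Lemma sub_setY (I : Type) (A B C : set I) :
  A `+` C `<=` (A `+` B) `|` (B `+` C).
Proof.
move=> x; have [Bx|nBx] := pselect (B x); case=> -[? ?].
- by right; left.
- by left; right.
- by left; left.
- by right; right.
Qed.

Lemma finite_setY_trans (I : Type) (B A C : set I) :
  finite_set (A `+` B) -> finite_set (B `+` C) -> finite_set (A `+` C).
Proof.
by move=> AB BC; apply: sub_finite_set (@sub_setY I A B C) _;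
  rewrite finite_setU.
Qed.

Lemma finite_setY_gaction (G : groupType) (S : Type) (a : gaction G S) g
  (A B : set S) :
  finite_set (A `+` B) -> finite_set ((a g @` A) `+` (a g @` B)).
Proof. by move=> ?; rewrite -gaction_imageY; exact: finite_image. Qed.

Lemma commensurated_near (G : groupType) (S : Type) (a : gaction G S)
  (R T : set S) : commensurated a R -> finite_set (T `+` R) ->
  commensurated a T.
Proof.
move=> cR TR g; apply: (@finite_setY_trans _ (a g @` R)).
  exact: finite_setY_gaction.
by apply: (@finite_setY_trans _ R); rewrite 1?(setYC R).
Qed.

(** * Bounded displacement and fixed sets *)

(** The squared l^2 distance of [f] and [f'] is at most [c]. Quantifying over
    finite partial sums gives infinite distances a meaning, with no summability
    to establish. *)
Definition sqdist_le (K : numDomainType) (S : eqType) (f f' : S -> K) (c : K) :=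
  forall E : seq S, uniq E -> \sum_(s <- E) (f s - f' s) ^+ 2 <= c.

Lemma sqdist_le_inj (K : numDomainType) (S : eqType) (f f' : S -> K) (c : K)
  (t : S -> S) : injective t -> sqdist_le f f' c ->
  sqdist_le (f \o t) (f' \o t) c.
Proof.
move=> tinj cf E uE.
rewrite -(big_map t xpredT (fun s => (f s - f' s) ^+ 2)); apply: cf.
by rewrite map_inj_uniq.
Qed.

(** If [f] and [f'] both lie in a ball around [x] and their midpoint is outside
    a smaller concentric ball, then they are close. The conclusion is pointwise
    because this is the form in which almost invariance is used. *)
Lemma parallelogram_midpoint (K : realFieldType) (S : eqType)
    (x f f' : S -> K) c r s :
  sqdist_le x f c -> sqdist_le x f' c ->
  ~ sqdist_le x (fun t => (f t + f' t) / 2) r ->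
  (f s - f' s) ^+ 2 <= 4 * (c - r).
Proof.
move=> xf xf' /existsNP[E /not_implyP[uE /negP]]; rewrite -ltNge => rE.
pose m t := (f t + f' t) / 2.
(* Partial sums increase with the set, so [s] may be added to [E]. *)
have [E' [uE' sE' rE']] : exists E' : seq S,
    [/\ uniq E', s \in E' & r < \sum_(t <- E') (x t - m t) ^+ 2].
  have [sE|sE] := boolP (s \in E); first by exists E.
  exists (s :: E); split; rewrite ?mem_head//= ?sE// big_cons.
  by rewrite (lt_le_trans rE)// lerDr sqr_ge0.
have /(_ E' uE') h := xf; have /(_ E' uE') h' := xf'.
have : (f s - f' s) ^+ 2 <= \sum_(t <- E') (f t - f' t) ^+ 2.
  rewrite (big_rem s)//= lerDl; apply: sumr_ge0 => ? _; exact: sqr_ge0.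
have -> : \sum_(t <- E') (f t - f' t) ^+ 2 =
    2 * (\sum_(t <- E') (x t - f t) ^+ 2)
    + 2 * (\sum_(t <- E') (x t - f' t) ^+ 2)
    - 4 * \sum_(t <- E') (x t - m t) ^+ 2.
  rewrite !mulr_sumr -big_split/= -sumrB; apply: eq_bigr => t _.
  by rewrite /m; field.
lra.
Qed.

(** The function is an almost minimizer of the radius of the orbit of the
    indicator of [R]. Its translates are almost minimizers for the same radius,
    and so are close to it by the parallelogram law. *)
Lemma almost_invariant_function (K : realType) (G : groupType) (S : choiceType)
    (a : gaction G S) (R : set S) (H : {pred G}) (N : nat) :
  group_closed H -> commensurated a R ->
  (forall h (E : seq S), h \in H -> uniq E ->
     [set` E] `<=` (a h @` R) `+` R -> (size E <= N)%N) ->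
  forall eps : K, 0 < eps -> exists f : S -> K,
    finite_set [set s | f s != (s \in R)%:R] /\
    forall h s, h \in H -> (f (a h s) - f s) ^+ 2 <= eps.
Proof.
move=> [H1 HV] cR bR eps eps0; pose x s : K := (s \in R)%:R.
have HVg h : h \in H -> h^-1%g \in H by move=> /(HV _ _ H1); rewrite div1g.
pose near f := finite_set [set s | f s != x s].
(* [x \o a h] is the indicator of the translate of [R] by [h^-1]. As [H] is
   closed under inversion, these are all the translates; so [P] consists of
   the squared radii of the balls that contain the orbit of [x] and have their
   center at finite distance from [x]. *)
pose P : set K := [set c | exists f, near f /\
  forall h, h \in H -> sqdist_le (x \o a h) f c].
have P0 : P !=set0.
  exists N%:R, x; split.
    by rewrite /near (_ : mkset _ = set0)// -subset0 => s /=; rewrite eqxx.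
  move=> h /HVg Hh E uE.
  rewrite (eq_bigr (fun s => ((a h s \in R) != (s \in R))%:R)); last first.
    by move=> s _ /=; rewrite /x; do 2 case: (_ \in _) => /=; ring.
  rewrite -natr_sum ler_nat; pose b s := (a h s \in R) != (s \in R).
  rewrite (eq_bigr (fun s => if b s then 1 else 0)%N); last first.
    by move=> s _; rewrite -/(b s); case: (b s).
  rewrite -big_mkcond sum1_count -size_filter; apply: (bR _ _ Hh).
    exact: filter_uniq.
  move=> s sb; apply/set_mem; rewrite in_setY in_gaction_image invgK -negb_eqb.
  by move: sb; rewrite /= mem_filter => /andP[].
have Plb c : P c -> 0 <= c.
  by move=> [f [_ /(_ _ H1 [::] isT)]]; rewrite big_nil.
have iP : has_inf P by split=> //; exists 0 => c /Plb.
have [|c [f [nf cf]] cr] := inf_adherent (_ : 0 < eps / 8) iP; first by lra.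
exists f; split=> // g s Hg.
pose f' := f \o a g.
have nf' : near f'.
  have : finite_set (a g^-1%g @` [set s | f s != x s] `|`
      ((a g^-1%g @` R) `+` R)).
    by rewrite finite_setU; split; [exact: finite_image|exact: cR].
  apply: sub_finite_set => t f't; have [E|ne] := eqVneq (x (a g t)) (x t).
    by left; apply/gaction_imageE; rewrite invgK /= E.
  right; apply/set_mem; rewrite in_setY in_gaction_image invgK -negb_eqb.
  by apply: contraNN ne => /eqP E; rewrite /x E.
have cf' h : h \in H -> sqdist_le (x \o a h) f' c.
  move=> Hh; have -> : x \o a h = (x \o a (h * g^-1)%g) \o a g.
    by apply/funext => t /=; rewrite -gactionM mulgVK.
  by apply: sqdist_le_inj; [exact: gaction_inj|apply: cf; exact: HV].
pose m t := (f t + f' t) / 2.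
have nm : near m.
  have : finite_set ([set s | f s != x s] `|` [set s | f' s != x s]).
    by rewrite finite_setU.
  apply: sub_finite_set => t /= mt; apply/orP; apply: contraNT mt.
  by rewrite negb_or !negbK /m => /andP[/eqP-> /eqP->]; apply/eqP; field.
have : ~ P (inf P - eps / 8).
  by move=> /(ge_inf (proj2 iP)); lra.
move=> nP; have [h Hh nh] : exists2 h, h \in H &
    ~ sqdist_le (x \o a h) m (inf P - eps / 8).
  apply: contra_notP nP => nP; exists m; split=> // h Hh.
  by apply: contra_notP nP => nh; exists h.
have := parallelogram_midpoint s (cf h Hh) (cf' h Hh) nh.
by rewrite -sqrrN opprB /f' /=; lra.
Qed.

(** Thresholding an almost invariant [f] orbitwise turns it into an invariant
    set: [T] collects the orbits on which [f] exceeds 1/2 somewhere. On such an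
    orbit [f] is everywhere at least 1/4, so that in passing from [R] to [T]
    membership only changes where [f] is not the indicator of [R]. *)
Lemma bounded_commensurated_fixed (K : realType) (G : groupType)
    (S : choiceType) (a : gaction G S) (R : set S) (H : {pred G}) (N : nat) :
  group_closed H -> commensurated a R ->
  (forall h (E : seq S), h \in H -> uniq E ->
     [set` E] `<=` (a h @` R) `+` R -> (size E <= N)%N) ->
  exists T : set S, finite_set (T `+` R) /\
    forall h, h \in H -> a h @` T = T.
Proof.
move=> HG cR bR; have [H1 HV] := HG.
have HVg h : h \in H -> h^-1%g \in H by move=> /(HV _ _ H1); rewrite div1g.
have e0 : 0 < 1 / 16 :> K by lra.
have [f [nf finv]] := almost_invariant_function HG cR bR e0.
pose T s := exists2 h, h \in H & 1 / 2 < f (a h s).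
have TS h s : h \in H -> T s -> T (a h s).
  move=> Hh [k Hk fk]; exists (k * h^-1)%g; first exact: HV.
  by rewrite -gactionM mulgVK.
exists T; split; last first.
  move=> h Hh; apply/seteqP; split=> [_ [s Ts <-]|s Ts]; first exact: TS.
  by apply/gaction_imageE; apply: TS Ts; exact: HVg.
apply: sub_finite_set nf => s [[[h Hh fh]]|[Rs nT]] /=.
  move=> nRs; rewrite memNset//; apply: contraTneq (finv h s Hh) => fs0.
  by rewrite fs0 -ltNge subr0 expr2; move: (f _) fh => y fh; nra.
rewrite mem_set//; apply/negP => /eqP fs; apply: nT; exists 1%g => //.
by rewrite gaction1 fs /=; lra.
Qed.

(** * Charts of the power set complex *)

(** Charts map edges to edges, and the edges of the power set complex are the
    intervals with two elements. *)
Lemma chart_edge (I : eqType) (A0 : set I) (n : nat)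
    (f : set 'I_n -> comp_vertex A0) (B : set 'I_n) (j : 'I_n) :
  is_chart (@comp_cube I A0) f -> ~ B j ->
  exists p, forall i,
    (i \in sval (f (j |` B))) = (i \in sval (f B)) (+) (i == p).
Proof.
move=> [finj fcube] nBj; set u := sval (f B); set v := sval (f (j |` B)).
have uv : u <> v.
  by move=> /sval_comp_inj/finj BjB; apply: nBj; rewrite BjB; left.
have : is_power_cube [set B; j |` B].
  apply/is_power_cubeP; exists B, (j |` B); split; first exact: subsetUr.
    by apply: sub_finite_set (finite_set1 j) => x [[]].
  apply/seteqP; split=> X /= => [[->|->]|[BX XjB]].
  - by split=> //; exact: subsetUr.
  - by split=> //; exact: subsetUr.
  have [Xj|nXj] := pselect (X j); [right|left]; apply/seteqP; split=> //.
    by move=> x [->|/BX].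
  by move=> x Xx; have [xj|//] := XjB _ Xx; case: nXj; rewrite -xj.
move/fcube/is_power_cubeP => [P [Q [PQ _ E]]].
(* Whichever of [P] and [Q] is [u], the other is [v], and they differ by one
   element because there is room in the interval for no third set. *)
have uvE X : P `<=` X -> X `<=` Q -> X = u \/ X = v.
  move=> PX XQ; have : [set X | P `<=` X /\ X `<=` Q] X by [].
  by rewrite -E => -[_ [_ [->|->] <-] <-]; [left|right].
have [Pu uQ] : P `<=` u /\ u `<=` Q.
  suff : [set X | P `<=` X /\ X `<=` Q] u by [].
  by rewrite -E; exists (f B) => //; exists B => //; left.
have [Pv vQ] : P `<=` v /\ v `<=` Q.
  suff : [set X | P `<=` X /\ X `<=` Q] v by [].
  by rewrite -E; exists (f (j |` B)) => //; exists (j |` B) => //; right.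
have uvEP := @uvE P (@subset_refl _ _) PQ.
have uvEQ := @uvE Q PQ (@subset_refl _ _).
have [p [Qp nPp]] : exists p, Q p /\ ~ P p.
  apply: contra_notP uv => nex; have QP : Q `<=` P.
    by move=> x Qx; apply: contra_notP nex => nPx; exists x.
  by apply/seteqP; split=> x; [move=> /uQ/QP/Pv|move=> /vQ/QP/Pu].
have pPQ : p |` P = Q.
  have [||E1|E1] := @uvE (p |` P).
  - exact: subsetUr.
  - by move=> x [->|/PQ].
  - have [] := uvEP => E2; first by case: nPp; rewrite E2 -E1; left.
    have [] := uvEQ => E3; first by rewrite E1 E3.
    by case: nPp; rewrite E2 -E3.
  - have [] := uvEP => E2; last by case: nPp; rewrite E2 -E1; left.
    have [] := uvEQ => E3; last by rewrite E1 E3.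
    by case: nPp; rewrite E2 -E3.
have flip i : (i \in Q) = (i \in P) (+) (i == p).
  rewrite -pPQ in_setU in_set1; have [->|_] := eqVneq i p.
    by rewrite (memNset nPp).
  by rewrite addbF.
exists p => i; have [] := uvEP => E2; have [] := uvEQ => E3.
- by case: nPp; rewrite E2 -E3.
- by rewrite -E2 -E3.
- by rewrite -E2 -E3 flip -addbA addbb addbF.
- by case: nPp; rewrite E2 -E3.
Qed.

(** The element [e j] flipped at the origin along direction [j] is also flipped
    along direction [j] everywhere else. For the inductive step, the images of
    [j :: s] and [k :: s] are obtained from that of [s] by flipping [e j] and
    [e k]; the image of [j :: k :: s] is adjacent to both, and distinct from
    that of [s], which leaves only one possibility. *)
Lemma chart_seq_flips (I : eqType) (A0 : set I) (n : nat)
    (f : set 'I_n -> comp_vertex A0) :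
  is_chart (@comp_cube I A0) f ->
  exists2 e : 'I_n -> I, injective e & forall (s : seq 'I_n) i, uniq s ->
    (i \in sval (f [set` s])) =
    (i \in sval (f set0)) (+) (i \in [seq e j | j <- s]).
Proof.
move=> fch; have [finj _] := fch.
have /choice[e eP] : forall j, exists p, forall i,
    (i \in sval (f [set j])) = (i \in sval (f set0)) (+) (i == p).
  by move=> j; have [//|p pP] := chart_edge (B := set0) (j := j) fch;
    exists p => i; rewrite -pP setU0.
have eqf B C : (forall i, (i \in sval (f B)) = (i \in sval (f C))) -> B = C.
  move=> E; apply/finj/sval_comp_inj/seteqP.
  by split=> i /mem_set Bi; apply/set_mem; move: Bi; rewrite E.
have einj : injective e.
  move=> j k ejk; have : [set j] = [set k].
    by apply: eqf => i; rewrite !eP ejk.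
  by move=> /seteqP[/(_ j erefl)].
have consE (j : 'I_n) s : [set` j :: s] = j |` [set` s].
  by apply/seteqP; split=> x /=; rewrite in_cons => /predU1P.
exists e => // s; have [m sm] := ubnP (size s).
elim: m s sm => // m IH [_ i _|j [_ i _|k s sm i us]] /=.
- by rewrite in_nil addbF set_nil.
- by rewrite set_cons1 eP mem_seq1.
have /and4P[jk js ks us'] : [&& j != k, j \notin s, k \notin s & uniq s].
  by move: us => /=; rewrite inE negb_or -andbA.
have sE l i' : l \notin s -> (size (l :: s) < m)%N ->
    (i' \in sval (f [set` l :: s])) =
    (i' \in sval (f [set` s])) (+) (i' == e l).
  move=> ls lm; rewrite !IH ?cons_uniq ?ls//; last exact: ltnW.
  rewrite map_cons in_cons -addbA; congr addb.
  have [->|_]/= := eqVneq i' (e l); last by rewrite addbF.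
  by rewrite mem_map// (negPf ls).
have jE i' := sE j i' js sm; have kE i' := sE k i' ks sm.
have [|p pE] := chart_edge (B := [set` k :: s]) (j := j) fch.
  by rewrite /= in_cons (negPf jk) (negPf js).
have [|q qE] := chart_edge (B := [set` j :: s]) (j := k) fch.
  by rewrite /= in_cons eq_sym (negPf jk) (negPf ks).
have swapE : j |` [set` k :: s] = k |` [set` j :: s].
  by rewrite !consE setUCA.
have pq i' : (i' == p) (+) (i' == e k) = (i' == q) (+) (i' == e j).
  move: (pE i'); rewrite swapE qE jE kE.
  by case: (_ \in _); do 4 case: (_ == _).
(* If the step along [j] undid the flip of [e k], it would lead back to the
   image of [s], against injectivity. *)
have npk : (e k == p) = false.
  apply/negP => /eqP kp; have jks : [set` j :: k :: s] = [set` s].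
    by apply: eqf => i'; rewrite consE pE kE kp -addbA addbb addbF.
  have : [set` j :: k :: s] j by rewrite /= mem_head.
  by rewrite jks /= (negPf js).
have kq : e k = q.
  apply/eqP; move: (pq (e k)); rewrite npk eqxx (inj_eq einj).
  by rewrite [k == j]eq_sym (negPf jk) addbF.
rewrite consE swapE qE IH ?cons_uniq ?js//.
rewrite -kq -addbA; congr addb; rewrite /= !in_cons.
have [->|_] := eqVneq i (e k); last by rewrite addbF.
by rewrite (inj_eq einj) [k == j]eq_sym (negPf jk) mem_map// (negPf ks).
Qed.

Lemma chart_flips (I : eqType) (A0 : set I) (n : nat)
    (f : set 'I_n -> comp_vertex A0) :
  is_chart (@comp_cube I A0) f ->
  exists2 e : 'I_n -> I, injective e & forall B i,
    (i \in sval (f B)) = (i \in sval (f set0)) (+) (i \in e @` B).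
Proof.
move=> /chart_seq_flips[e einj eP]; exists e => // B i.
pose s := enum [pred j | j \in B].
have sB j : (j \in s) = (j \in B) by rewrite mem_enum.
have -> : B = [set` s].
  by apply/seteqP; split=> j /=; rewrite sB inE.
rewrite eP ?enum_uniq//; congr addb; apply/mapP/idP.
  by move=> [j sj ->]; apply/mem_set; exists j.
by move=> /set_mem[j /= sj <-]; exists j.
Qed.

(** * A Lipschitz map to functions on the ground set *)

Definition chart_slope (K : nzRingType) (I : Type) (A0 : set I) (n : nat)
    (f : set 'I_n -> comp_vertex A0) (i : I) : 'cV[K]_n :=
  \col_j ((i \in sval (f [set j]))%:R - (i \in sval (f set0))%:R).

(** Value at [i] of the affine extension over the cube [f] of the indicators of
    its vertices. *)
Definition chart_coord (K : nzRingType) (I : Type) (A0 : set I) (n : nat)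
    (f : set 'I_n -> comp_vertex A0) (x : 'rV[K]_n) (i : I) : K :=
  (i \in sval (f set0))%:R + (x *m chart_slope K f i) 0 0.

Lemma chart_slopeE (K : nzRingType) (I : eqType) (A0 : set I) (n : nat)
    (f : set 'I_n -> comp_vertex A0) :
  is_chart (@comp_cube I A0) f ->
  exists2 e : 'I_n -> I, injective e & forall i j,
    chart_slope K f i j 0 = (-1) ^+ (i \in sval (f set0)) * (i == e j)%:R.
Proof.
move=> /chart_flips[e einj eP]; exists e => // i j.
rewrite mxE eP image_set1 in_set1.
by case: (_ \in _); case: (_ == _);
  rewrite /= ?mulr1 ?mulr0 ?subrr ?subr0 ?sub0r.
Qed.

Lemma sum_pick (K : nzRingType) (n : nat) (I : eqType) (e : 'I_n -> I)
    (x : 'I_n -> K) j : injective e ->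
  \sum_k x k * (e j == e k)%:R = x j.
Proof.
move=> einj; rewrite (bigD1 j)//= eqxx mulr1 big1 ?addr0// => k kj.
by rewrite (inj_eq einj) eq_sym (negPf kj) mulr0.
Qed.

Lemma sum_pick0 (K : nzRingType) (n : nat) (I : eqType) (e : 'I_n -> I)
    (x : 'I_n -> K) i : (forall j, i <> e j) ->
  \sum_k x k * (i == e k)%:R = 0.
Proof.
by move=> ie; rewrite big1// => k _; case: eqP => [/ie//|_]; rewrite mulr0.
Qed.

(** An affine function is determined by its values at the origin and at the
    unit vectors; that it is right at all the other corners reflects that each
    [i] is flipped along at most one direction. *)
Lemma chart_coord_corner (K : realType) (I : eqType) (A0 : set I) (n : nat)
    (f : set 'I_n -> comp_vertex A0) (B : set 'I_n) i :
  is_chart (@comp_cube I A0) f ->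
  chart_coord f (corner K B) i = (i \in sval (f B))%:R.
Proof.
move=> /chart_flips[e einj eP]; rewrite /chart_coord mxE.
have -> : \sum_j corner K B 0 j * chart_slope K f i j 0 =
    (-1) ^+ (i \in sval (f set0)) * \sum_j (j \in B)%:R * (i == e j)%:R.
  rewrite mulr_sumr; apply: eq_bigr => j _.
  rewrite !mxE eP image_set1 in_set1.
  by case: (_ \in sval _); case: (_ == _) => /=; ring.
rewrite (eP B); have [[j ->]|nej] := pselect (exists j, i = e j).
  rewrite sum_pick//; have -> : (e j \in e @` B) = (j \in B).
    apply/idP/idP => [/set_mem[k Bk /einj<-]|/set_mem Bj]; first exact/mem_set.
    by apply/mem_set; exists j.
  by do 2 case: (_ \in _) => /=; ring.
rewrite sum_pick0; last by move=> j ij; apply: nej; exists j.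
rewrite (_ : i \in e @` B = false) ?addbF ?mulr0 ?addr0//.
by apply/negP => /set_mem[j _ ij]; apply: nej; exists j.
Qed.

Lemma corner_set0 (K : realType) n : corner K (set0 : set 'I_n) = 0.
Proof. by apply/rowP => j; rewrite !mxE in_set0. Qed.

Lemma corner_set1 (K : realType) n (j : 'I_n) : corner K [set j] = delta_mx 0 j.
Proof. by apply/rowP => k; rewrite !mxE in_set1 eqxx. Qed.

Definition point_coord (K : realType) (I : Type) (A0 : set I)
    (p : rpoint K (power_component A0)) : I -> K :=
  chart_coord (pchart p) (pcoord p).

(** Both sides are affine functions on the smaller cube, and they agree at its
    corners; the origin and the unit vectors are enough to compare them. *)
Lemma glued_point_coord (K : realType) (I : eqType) (A0 : set I)
    (p q : rpoint K (power_component A0)) i :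
  glued p q -> point_coord p i = point_coord q i.
Proof.
move=> [M [b [corners qp]]]; rewrite /point_coord qp.
pose fp : set 'I_(pdim p) -> comp_vertex A0 := pchart p.
pose fq : set 'I_(pdim q) -> comp_vertex A0 := pchart q.
rewrite -/fp -/fq.
set D := chart_slope K fq i; set c : K := (i \in sval (fq set0))%:R.
have affq B : (i \in sval (fp B))%:R = c + ((corner K B *m M + b) *m D) 0 0.
  have [B' qB'] := corners B; rewrite -/fq -/fp in qB'; move=> <-.
  by rewrite -qB' -(chart_coord_corner K)//; exact: pchartP.
rewrite /chart_coord -/D -/c affq corner_set0 mul0mx add0r.
have -> : chart_slope K fp i = M *m D.
  apply/colP => j; rewrite [LHS]mxE !affq corner_set0 corner_set1 mul0mx add0r.
  rewrite mulmxDl -mulmxA -rowE [(_ + _ :'M_(_,_)) 0 0]mxE [row _ _ _ _]mxE.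
  by ring.
by rewrite mulmxDl [(_ + _ :'M_(_,_)) 0 0]mxE mulmxA; ring.
Qed.

(** The Cauchy-Schwarz inequality, for weights bounded by 1. *)
Lemma weighted_sum_le (K : rcfType) (I : eqType) (E : seq I) (w z : I -> K) :
  (forall i, w i ^+ 2 <= 1) ->
  \sum_(i <- E) w i * z i <=
    Num.sqrt (size E)%:R * Num.sqrt (\sum_(i <- E) z i ^+ 2).
Proof.
move=> w1; set s := Num.sqrt _; set t := Num.sqrt _.
have s0 : 0 <= s := sqrtr_ge0 _; have t0 : 0 <= t := sqrtr_ge0 _.
have s2 : s ^+ 2 = (size E)%:R by rewrite sqr_sqrtr.
have z20 : 0 <= \sum_(i <- E) z i ^+ 2.
  by apply: sumr_ge0 => i _; exact: sqr_ge0.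
have t2 : t ^+ 2 = \sum_(i <- E) z i ^+ 2 by rewrite sqr_sqrtr.
(* The inequality of arithmetic and geometric means for the pairs [t * w i] and
   [s * z i], multiplied out so that [s] and [t] may vanish. *)
have amgm : 2 * (s * t) * \sum_(i <- E) w i * z i <= 2 * (s * t) * (s * t).
  have -> : 2 * (s * t) * (s * t) =
      t ^+ 2 * (size E)%:R + s ^+ 2 * \sum_(i <- E) z i ^+ 2.
    by rewrite -s2 -t2; ring.
  rewrite -sum1_size natr_sum !mulr_sumr -big_split/=.
  apply: ler_sum => i _.
  have : 0 <= (t * w i - s * z i) ^+ 2 := sqr_ge0 _.
  have : t ^+ 2 * w i ^+ 2 <= t ^+ 2 * 1 by rewrite ler_wpM2l ?sqr_ge0.
  lra.
have [st|st] := ltP 0 (s * t); first by move: amgm; rewrite ler_pM2l// mulr_gt0.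
apply: le_trans (mulr_ge0 s0 t0); rewrite le_eqVlt; apply/orP; left.
have : s * t == 0 by rewrite eq_le st mulr_ge0.
rewrite mulf_eq0 => /orP[/eqP sE|/eqP tE].
  move: s2; rewrite sE expr0n /= => /esym/eqP; rewrite pnatr_eq0 size_eq0.
  by move=> /eqP->; rewrite big_nil.
have /esym/eqP := t2; rewrite tE expr0n /= psumr_eq0 => [/allP z0|i _];
  last exact: sqr_ge0.
rewrite big_seq big1// => i /z0/eqP/eqP; rewrite sqrf_eq0 => /eqP->.
by rewrite mulr0.
Qed.

(** The coordinates of the chart appear as coordinates at distinct elements of
    the ground set, up to sign, while the other elements have constant
    coordinate. So the map is isometric on the cube, and testing it against [u]
    on [E] costs a factor [sqrt (size E)]. *)
Lemma chart_coord_lipschitz (K : realType) (I : eqType) (A0 : set I) (n : nat)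
    (f : set 'I_n -> comp_vertex A0) (x y : 'rV[K]_n) (E : seq I) (u : I -> K) :
  is_chart (@comp_cube I A0) f -> uniq E -> (forall i, u i ^+ 2 <= 1) ->
  \sum_(i <- E) u i * (chart_coord f y i - chart_coord f x i) <=
    Num.sqrt (size E)%:R * euclid x y.
Proof.
move=> /(chart_slopeE K)[e einj slope] uE u1.
pose z i := \sum_j (y 0 j - x 0 j) * (i == e j)%:R.
pose w i := u i * (-1) ^+ (i \in sval (f set0)).
rewrite (eq_bigr (fun i => w i * z i)); last first.
  move=> i _; rewrite -mulrA; congr (_ * _); rewrite /chart_coord.
  rewrite opprD addrACA subrr add0r !mxE -sumrB mulr_sumr.
  by apply: eq_bigr => j _; rewrite slope; ring.
apply: le_trans (weighted_sum_le _ _ _) _ => [i|].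
  by rewrite exprMn sqrr_sign mulr1.
rewrite ler_wpM2l ?sqrtr_ge0// ler_wsqrtr//.
have -> : \sum_(i <- E) z i ^+ 2 =
    \sum_(i <- E) \sum_j (x 0 j - y 0 j) ^+ 2 * (i == e j)%:R.
  apply: eq_bigr => i _; have [[j ->]|nej] := pselect (exists j, i = e j).
    by rewrite /z !sum_pick//; ring.
  by rewrite /z !sum_pick0 ?expr0n// => j ij; apply: nej; exists j.
rewrite exchange_big/=; apply: ler_sum => j _.
rewrite -mulr_sumr ler_piMr ?sqr_ge0// -natr_sum lern1.
rewrite (eq_bigr (fun i => if i == e j then 1 else 0)%N); last first.
  by move=> i _; case: (_ == _).
by rewrite -big_mkcond sum1_count count_uniq_mem//; case: (_ \in _).
Qed.

(** The inequality adds up along a path, since gluing does not change the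
    coordinates. *)
Lemma cube_path_lower_bound (K : realType) (I : eqType) (A0 : set I)
    (p q : rpoint K (power_component A0)) (l : K) (E : seq I) (u : I -> K) :
  uniq E -> (forall i, u i ^+ 2 <= 1) -> cube_path p q l ->
  \sum_(i <- E) u i * (point_coord q i - point_coord p i) <=
    Num.sqrt (size E)%:R * l.
Proof.
move=> uE u1; elim=> {p q l}.
- by move=> p; rewrite mulr0 big1// => i _; rewrite subrr mulr0.
- move=> p q r l pq _ IH; apply: le_trans IH; apply: ler_sum => i _.
  rewrite le_eqVlt; apply/orP; left; apply/eqP; congr (_ * (_ - _)).
  by case: pq => /(@glued_point_coord _ _ _ _ _ i).
move=> n f fP x y xP yP r l _ IH; rewrite mulrDr.
apply: le_trans (lerD (chart_coord_lipschitz x y fP uE u1) IH).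
rewrite -big_split/=; apply: ler_sum => i _; rewrite le_eqVlt; apply/orP; left.
by apply/eqP; rewrite /point_coord/= -mulrDr; congr (_ * _); ring.
Qed.

(** * The action on the component *)

Lemma is_power_cube_gaction (G : groupType) (S : Type) (a : gaction G S) g
  (D : set (set S)) :
  is_power_cube D -> is_power_cube [set a g @` X | X in D].
Proof.
move=> /is_power_cubeP[A [B [AB finBA ->]]]; apply/is_power_cubeP.
exists (a g @` A), (a g @` B); split; first exact: image_subset.
  apply: sub_finite_set (finite_image (a g) finBA).
  by move=> s [/gaction_imageE Bs nA]; apply/gaction_imageE; split=> //;
    move=> As; apply: nA; apply/gaction_imageE.
apply/seteqP; split=> X /=.
  by move=> [Y [AY YB] <-]; split; exact: image_subset.
move=> [AX XB]; exists (a g^-1%g @` X); last first.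
  by rewrite -gaction_imageM mulgV gaction_image1.
split=> s.
  by move=> As; apply/gaction_imageE; rewrite invgK; apply: AX; exists s.
by move=> [t /XB/gaction_imageE Bt <-].
Qed.

Lemma component_act_subproof (G : groupType) (S : Type) (a : gaction G S)
    (R : set S) (cR : commensurated a R) g (v : comp_vertex R) :
  finite_set ((a g @` sval v) `+` R).
Proof.
apply: finite_setY_trans (cR g); apply: finite_setY_gaction.
exact: (proj2_sig v).
Qed.

Definition component_act (G : groupType) (S : Type) (a : gaction G S)
    (R : set S) (cR : commensurated a R) g (v : comp_vertex R) :
    comp_vertex R :=
  exist _ (a g @` sval v) (component_act_subproof cR g v).

Lemma component_act1 (G : groupType) (S : Type) (a : gaction G S)
    (R : set S) (cR : commensurated a R) v : component_act cR 1%g v = v.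
Proof. by apply: sval_comp_inj; rewrite /= gaction_image1. Qed.

Lemma component_actM (G : groupType) (S : Type) (a : gaction G S)
    (R : set S) (cR : commensurated a R) g h v :
  component_act cR (g * h)%g v = component_act cR g (component_act cR h v).
Proof. by apply: sval_comp_inj; rewrite /= gaction_imageM. Qed.

Definition component_gaction (G : groupType) (S : Type) (a : gaction G S)
    (R : set S) (cR : commensurated a R) :
    gaction G (vertex (power_component R)) :=
  GAction (component_act1 cR) (component_actM cR).

Lemma component_gaction_iso (G : groupType) (S : Type) (a : gaction G S)
    (R : set S) (cR : commensurated a R) g :
  cubical_iso (component_gaction cR g).
Proof.
have cubeS h c : comp_cube c -> comp_cube (component_gaction cR h @` c).
  move=> /(is_power_cube_gaction a h); rewrite /comp_cube /= !image_comp.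
  by congr is_power_cube.
split=> [|c].
  exists (component_gaction cR g^-1%g); first exact: gactionK.
  exact: gactionKV.
split=> [|/(cubeS g^-1%g) gc]; first exact: cubeS.
have E := gaction_imageM (component_gaction cR) g^-1%g g c.
rewrite mulVg gaction_image1 in E; rewrite E; exact: gc.
Qed.

Definition component_action (G : groupType) (S : Type) (a : gaction G S)
    (R : set S) (cR : commensurated a R) :
    cubicalAction G (power_component R) :=
  CubicalAction (component_gaction_iso cR).

(** * Bounded orbits and stabilizers *)

(** Let the weight be the difference of the indicators of [h v] and [v]. On a
    subset [E] of their symmetric difference it increases by [size E] from [v]
    to [h v], while the path is at most [M + 1 + D] long, [D] being the cost of
    going from [v] to [p] and from [h p] to [h v] inside cubes. Hence
    [size E <= sqrt (size E) * (M + 1 + D)]. *)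
Lemma bounded_orbit_bounded_discrepancy (K : realType) (G : groupType)
    (S : eqType) (a : gaction G S) (R : set S) (cR : commensurated a R)
    (H : {pred G}) (p : rpoint K (power_component R)) (v : comp_vertex R) :
  v = pchart p set0 -> 1%g \in H ->
  dist_bounded (point_orbit (component_action cR) H p) ->
  exists N, forall h (E : seq S), h \in H -> uniq E ->
    [set` E] `<=` (a h @` sval v) `+` sval v -> (size E <= N)%N.
Proof.
move=> vp H1 [M bM]; set b := component_action cR in bM.
pose x := pcoord p; pose D := euclid x 0 + euclid 0 x.
pose C := M + 1 + D.
exists (Num.bound (C ^+ 2)) => h E Hh uE EY.
have /(@le_lt_trans _ _ _ _ (M + 1)%:E) :
    (dist (pact b 1%g p) (pact b h p) <= M%:E)%E.
  by apply: bM; [exists 1%g|exists h].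
rewrite lte_fin ltrDl ltr01 => /(_ isT)/ereal_inf_lt[_ [l lP <-]].
rewrite lte_fin => lM.
pose u i : K := (i \in a h @` sval v)%:R - (i \in sval v)%:R.
have u1 i : u i ^+ 2 <= 1.
  by rewrite /u; do 2 case: (_ \in _) => /=; lra.
have uE1 i : i \in E -> u i * u i = 1.
  move=> /EY/mem_set; rewrite in_setY /u.
  by case: (_ \in _); case: (_ \in _) => // _; rewrite /=; ring.
set s := Num.sqrt (size E)%:R : K.
pose f g : set 'I_(pdim p) -> comp_vertex R := component_act cR g \o pchart p.
have fP g : is_chart (@comp_cube S R) (f g) := pchartP (pact b g p).
(* The path has to start at a point of the orbit, whence [1%g] in place of the
   identity. *)
have B1 : \sum_(i <- E) u i * (chart_coord (f h) x i - chart_coord (f 1%g) x i)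
    <= s * l := cube_path_lower_bound uE u1 lP.
have B2 := chart_coord_lipschitz x 0 (fP h) uE u1.
have B3 := chart_coord_lipschitz 0 x (fP 1%g) uE u1.
have f0 g i : chart_coord (f g) 0 i = (i \in a g @` sval v)%:R :> K.
  by rewrite -corner_set0 chart_coord_corner// /f /= -vp.
have sE : s ^+ 2 = (size E)%:R by rewrite sqr_sqrtr.
have sC : s ^+ 2 <= s * C.
  have -> : s ^+ 2 = \sum_(i <- E)
      u i * (chart_coord (f h) 0 i - chart_coord (f 1%g) 0 i).
    rewrite sE -sum1_size natr_sum big_seq [RHS]big_seq; apply: eq_bigr => i iE.
    by rewrite !f0 gaction_image1 -/(u i) uE1.
  have s0 : 0 <= s := sqrtr_ge0 _.
  have sl : s * l <= s * (M + 1) by rewrite ler_wpM2l// ltW.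
  rewrite /C /D !mulrDr -[s * M + s * 1]mulrDr.
  apply: le_trans (lerD sl (lerD B2 B3)); apply: le_trans (lerD B1 (lexx _)).
  rewrite -!big_split/=; apply: ler_sum => i _; lra.
have : (size E)%:R <= C ^+ 2.
  rewrite -sE; have : 0 <= s := sqrtr_ge0 _.
  rewrite le_eqVlt => /predU1P[<-|s0]; first by rewrite expr0n sqr_ge0.
  have sC' : s <= C by move: sC; rewrite expr2 ler_pM2l.
  by rewrite ler_pXn2r// nnegrE ltW// (lt_le_trans s0).
move=> /le_lt_trans/(_ (archi_boundP (sqr_ge0 _))); rewrite ltr_nat.
exact: ltnW.
Qed.

Lemma infinite_cube_component (I : Type) (A : set I) :
  infinite_set [set: I] -> infinite_cube (power_component A).
Proof.
move=> infI; exists I, A; split=> //; exists id; split=> [|c].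
  by exists id.
by rewrite image_id.
Qed.

Lemma fixed_vertex_of_bounded_orbit (K : realType) (G : groupType)
    (S : choiceType) (a : gaction G S) (R : set S) (cR : commensurated a R)
    (H : {pred G}) (p : rpoint K (power_component R)) :
  group_closed H -> dist_bounded (point_orbit (component_action cR) H p) ->
  exists v, forall h, h \in H -> component_action cR h v = v.
Proof.
move=> HG bp; pose v : comp_vertex R := pchart p set0.
have [N NP] := bounded_orbit_bounded_discrepancy (erefl v) (proj1 HG) bp.
have cv : commensurated a (sval v) := commensurated_near cR (proj2_sig v).
have [T [Tv TH]] := bounded_commensurated_fixed K HG cv NP.
have TR : finite_set (T `+` R) := finite_setY_trans Tv (proj2_sig v).
exists (exist _ T TR : comp_vertex R) => h /TH hT; exact: sval_comp_inj.
Qed.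

(** A set invariant under a transitive action is empty or full, hence at
    infinite distance from [R]. *)
Lemma no_fixed_vertex (G : groupType) (S : Type) (a : gaction G S)
    (R : set S) (cR : commensurated a R) :
  transitive_action a -> infinite_set R -> infinite_set (~` R) ->
  ~ exists v, forall g, component_action cR g v = v.
Proof.
move=> tra infR infC [[T TR] fixT].
have aT g s : T s -> T (a g s).
  by have /(congr1 sval)/= {2}<- := fixT g; exists s.
have [[s Ts]|T0] := pselect (exists s, T s).
  apply: infC; suff -> : ~` R = T `+` R by [].
  have -> : T = setT.
    by apply/seteqP; split=> // t _; have [g <-] := tra s t; exact: aT.
  by rewrite setTYC.
apply: infR; suff -> : R = T `+` R by [].
suff -> : T = set0 by rewrite set0Y.
by rewrite -subset0 => s Ts; apply: T0; exists s.
Qed.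

(** The least element [A] of the interval [c] is fixed, because the action
    preserves inclusion. *)
Lemma stabilizer_cube_sub (G : groupType) (S : Type) (a : gaction G S)
    (R : set S) (cR : commensurated a R) (c : set (comp_vertex R)) :
  comp_cube c -> exists2 A : set S, finite_set (A `+` R) &
    stabilizer (component_action cR) c `<=` stabilizer a A.
Proof.
move=> /is_power_cubeP[A [B [AB _ E]]].
have [w cw wA] : (sval @` c) A by rewrite E; split.
exists A; first by rewrite -wA; exact: (proj2_sig w).
have sub g : stabilizer (component_action cR) c g -> A `<=` a g @` A.
  move=> gc; have : (sval @` c) (a g @` A).
    exists (component_action cR g w); last by rewrite /= wA.
    by rewrite -[X in X _]gc; exists w.
  by rewrite E => -[].
move=> g gc; apply/seteqP; split; last exact: sub.
move=> _ [s As <-].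
have : stabilizer (component_action cR) c g^-1%g.
  by rewrite /stabilizer /= -[in LHS]gc -gaction_imageM mulVg gaction_image1.
by move=> /sub/(_ _ As)/gaction_imageE; rewrite invgK.
Qed.

Theorem theorem1 (K : realType) (G : groupType) (S : Type) (a : gaction G S)
    (R : set S) :
  transitive_action a ->
  commensurated a R -> infinite_set R -> infinite_set (~` R) ->
  exists (X : cubeComplex) (b : cubicalAction G X),
    [/\ infinite_cube X,
        forall p : rpoint K X, ~ dist_bounded (point_orbit b predT p),
        forall H : {pred G}, group_closed H ->
          (forall p : rpoint K X, dist_bounded (point_orbit b H p)) ->
          exists v : vertex X, forall h, h \in H -> b h v = v
      & (forall T : set S, finite_set (T `+` R) ->
           finite_set (stabilizer a T)) ->
        proper_action b].
Proof.
move=> tra cR infR infC.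
(* Finite subsets of [S] are handled as lists without repetition, which takes a
   decidable equality on [S]. *)
have fixv := @fixed_vertex_of_bounded_orbit K G {classic S} a R cR.
exists (power_component R), (component_action cR); split.
- apply: infinite_cube_component => finS; apply: infR.
  exact: sub_finite_set finS.
- move=> p /fixv[|v vfix]; first by split.
  apply: (no_fixed_vertex tra infR infC).
  by exists v => g; exact: vfix.
- move=> H HG bp.
  have RR : finite_set (R `+` R) by rewrite setYK.
  have [n [f [fch _]]] :=
    comp_cube_chart (comp_cube1 (exist _ R RR : comp_vertex R)).
  have x01 (i : 'I_n) : 0 <= (0 : 'rV[K]_n) 0 i <= 1 by rewrite mxE lexx ler01.
  exact: (fixv H (@RPoint K (power_component R) n f fch 0 x01)).
move=> stabfin c /(stabilizer_cube_sub cR)[A AR sub].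
exact: sub_finite_set sub (stabfin A AR).
Qed.
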